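(* Let $f$, $\Psi$, $L_f$, $\mu_f$, $\mu_\Psi$, $\mu=\mu_f+\mu_\Psi$ be as in the context, let $x_0\in\mathbb{R}^n$, $L_0>0$, $r_u>1$, $0<r_d<1$, and let $\{A_k\}_{k\ge 0}$ be the convergence guarantee (accumulated weight sequence) generated by the Accelerated Composite Gradient Method (ACGM) described in the context. Put $$L_u = \max\{r_u L_f,\; r_d L_0\},\qquad q_u=\frac{\mu}{L_u+\mu_\Psi}.$$ Then: (i) in the non-strongly convex case ($\mu=0$), $$A_k \ge \frac{(k+1)^2}{4L_u}\quad\text{for all } k\ge 1;$$ (ii) in the strongly convex case ($\mu>0$), $$A_k \ge \frac{1}{L_u-\mu_f}\,\bigl(1-\sqrt{q_u}\bigr)^{-(k-1)}\quad\text{for all } k\ge 1.$$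
   Context: Problem: minimize $F(x)=f(x)+\Psi(x)$ over $x\in\mathbb{R}^n$, where $F$ has a non-empty set of minimizers $X^*$. The function $f:\mathbb{R}^n\to\mathbb{R}$ is convex and differentiable, its gradient is Lipschitz with constant $L_f>0$ (Euclidean norm), and it has strong convexity parameter $\mu_f\ge 0$ (i.e. $f-\frac{\mu_f}{2}\|\cdot\|_2^2$ is convex). The function $\Psi:\mathbb{R}^n\to\mathbb{R}\cup\{\infty\}$ is proper, lower semicontinuous and convex with strong convexity parameter $\mu_\Psi\ge 0$, and is infinite outside a closed convex feasible set. Put $\mu=\mu_f+\mu_\Psi$. Notation: $\operatorname{prox}_{\tau\Psi}(x)=\arg\min_{z\in\mathbb{R}^n}\bigl(\Psi(z)+\frac{1}{2\tau}\|z-x\|_2^2\bigr)$ for $\tau>0$, and $Q_{f,\gamma,y}(x)=f(y)+\langle\nabla f(y),x-y\rangle+\frac{\gamma}{2}\|x-y\|_2^2$. ACGM: Inputs are $x_0\in\mathbb{R}^n$, an initial Lipschitz constant estimate $L_0>0$, and line-search parameters $r_u>1$, $0<r_d<1$. Initialize $v_0=x_0$, $A_0=0$, $\gamma_0=1$. For $k=0,1,2,\dots$: 1. Set $\hat L=r_dL_k$. 2. Compute $$\hat a=\frac{\gamma_k+A_k\mu+\sqrt{(\gamma_k+A_k\mu)^2+4(\hat L-\mu_f)A_k\gamma_k}}{2(\hat L-\mu_f)},\quad \hat A=A_k+\hat a,\quad \hat\gamma=\gamma_k+\hat a\mu,$$ $$\hat y=\frac{A_k\hat\gamma\,x_k+\hat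 a\gamma_k v_k}{A_k\hat\gamma+\hat a\gamma_k},\qquad \hat x=\operatorname{prox}_{\frac{1}{\hat L}\Psi}\Bigl(\hat y-\tfrac{1}{\hat L}\nabla f(\hat y)\Bigr).$$ 3. If $f(\hat x)\le Q_{f,\hat L,\hat y}(\hat x)$, go to step 4. Otherwise replace $\hat L$ by $r_u\hat L$ and return to step 2. 4. Set $L_{k+1}=\hat L$, $a_{k+1}=\hat a$, $A_{k+1}=\hat A$, $\gamma_{k+1}=\hat\gamma$, $y_{k+1}=\hat y$, $x_{k+1}=\hat x$, and $$v_{k+1}=\frac{1}{\gamma_{k+1}}\bigl(\gamma_kv_k+a_{k+1}(L_{k+1}+\mu_\Psi)x_{k+1}-a_{k+1}(L_{k+1}-\mu_f)y_{k+1}\bigr).$$ It is assumed that every estimate $\hat L$ tried by the method satisfies $\hat L>\mu_f$, so that all the formulas are well defined and all weights $a_{k+1}$ are positive. Terminology: the sequence $\{A_k\}$ is called the convergence guarantee because it is the weight sequence in the bound by which the convergence rate is expressed, $A_k(F(x_k)-F(x^* ))\le\frac12\|x_0-x^*\|_2^2$ for $x^*\in X^*$, $k\ge 0$. *)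

(* Defs.v *)
From HB Require Import structures.
From mathcomp Require Import all_boot all_order all_algebra.
From mathcomp Require Import all_classical all_reals all_analysis.

Set Implicit Arguments.
Unset Strict Implicit.
Unset Printing Implicit Defensive.

Import Order.TTheory GRing.Theory Num.Theory.
Import numFieldNormedType.Exports.
Local Open Scope classical_set_scope.
Local Open Scope ring_scope.

Section Euclidean.
Context {R : realType} {n : nat}.
Implicit Types (x y u v : 'rV[R]_n) (f : 'rV[R]_n -> R) (g : 'rV[R]_n -> \bar R).

Definition dotv u v : R := \sum_(i < n) u 0 i * v 0 i.

(* The library norm `|u| on 'rV[R]_n is the sup norm, hence this one. *)
Definition enorm u : R := Num.sqrt (dotv u u).

Definition gradient f x : 'rV[R]_n :=
  \row_(i < n) 'D_(delta_mx 0 i) (f : 'rV[R]_n -> R^o) x.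

Definition lipschitz_gradient (L : R) f :=
  forall x y, enorm (gradient f x - gradient f y) <= L * enorm (x - y).

Definition strongly_convex_parameter (mu : R) f :=
  convex_function setT (fun x => f x - mu / 2 * enorm x ^+ 2).

(* With 0 < t < 1 the weights never meet the convention 0 * +oo = 0, and
   +oo + -oo does not occur for functions that do not take the value -oo. *)
Definition econvex_function g :=
  forall x y (t : R), 0 < t -> t < 1 ->
    (g (t *: x + (1 - t) *: y)%R <= t%:E * g x + (1 - t)%:E * g y)%E.

Definition estrongly_convex_parameter (mu : R) g :=
  econvex_function (fun x => g x - (mu / 2 * enorm x ^+ 2)%:E)%E.

Definition eproper g :=
  (forall x, g x != -oo%E) /\ (exists x, g x != +oo%E).

Definition argmin g : set 'rV[R]_n := [set z | forall w, (g z <= g w)%E].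

(* As a set; it is a singleton when g is proper, lower semicontinuous and
   convex. *)
Definition prox (tau : R) g x : set 'rV[R]_n :=
  argmin (fun z => g z + ((2 * tau)^-1 * enorm (z - x) ^+ 2)%:E)%E.

Definition quad_model f (gamma : R) y x : R :=
  f y + dotv (gradient f y) (x - y) + gamma / 2 * enorm (x - y) ^+ 2.

End Euclidean.

Section ACGM.
Context {R : realType} {n : nat}.

Record acgm_state := AcgmState {
  st_x : 'rV[R]_n;
  st_v : 'rV[R]_n;
  st_A : R;
  st_gamma : R;
  st_L : R }.

Variables (f : 'rV[R]_n -> R) (Psi : 'rV[R]_n -> \bar R).
Variables (mu_f mu_Psi r_u r_d : R).

Let mu := mu_f + mu_Psi.

Section Trial.
Variables (s : acgm_state) (Lhat : R).

Let A := st_A s.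
Let gamma := st_gamma s.

Definition a_hat : R :=
  (gamma + A * mu
     + Num.sqrt ((gamma + A * mu) ^+ 2 + 4 * (Lhat - mu_f) * A * gamma))
  / (2 * (Lhat - mu_f)).

Definition A_hat : R := A + a_hat.

Definition gamma_hat : R := gamma + a_hat * mu.

Definition y_hat : 'rV[R]_n :=
  (A * gamma_hat + a_hat * gamma)^-1
    *: ((A * gamma_hat) *: st_x s + (a_hat * gamma) *: st_v s).

Definition is_x_hat (x : 'rV[R]_n) : Prop :=
  prox Lhat^-1 Psi (y_hat - Lhat^-1 *: gradient f y_hat) x.

Definition sufficient_decrease (x : 'rV[R]_n) : bool :=
  f x <= quad_model f Lhat y_hat x.

Definition next_state (x : 'rV[R]_n) : acgm_state :=
  AcgmState x
    (gamma_hat^-1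
       *: (gamma *: st_v s + (a_hat * (Lhat + mu_Psi)) *: x
             - (a_hat * (Lhat - mu_f)) *: y_hat))
    A_hat gamma_hat Lhat.

End Trial.

(* The estimates tried by the line search in the iteration that starts in
   state s. *)
Inductive tried (s : acgm_state) : R -> Prop :=
| tried_first : tried s (r_d * st_L s)
| tried_backtrack Lhat x : tried s Lhat -> is_x_hat s Lhat x ->
    ~~ sufficient_decrease s Lhat x -> tried s (r_u * Lhat).

Definition acgm_step (s s' : acgm_state) : Prop :=
  exists Lhat x, [/\ tried s Lhat, is_x_hat s Lhat x,
    sufficient_decrease s Lhat x & s' = next_state s Lhat x].

Definition acgm_run (x0 : 'rV[R]_n) (L0 : R) (s : nat -> acgm_state) : Prop :=
  s 0%N = AcgmState x0 x0 0 1 L0 /\ forall k, acgm_step (s k) (s k.+1).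

End ACGM.

Arguments acgm_state : clear implicits.

(* Main.v *)
(* By the descent lemma the line search stops as soon as the estimate reaches
   L_f, so every accepted estimate is at most L_u.  Since
   gamma_k = 1 + A_k mu, the quadratic equation defining the weight
   a = a_(k+1) becomes
     (L_(k+1) + mu_Psi) a^2 = A_(k+1) (1 + A_(k+1) mu).
   For mu = 0 this reads A_(k+1) = L_(k+1) a^2, which makes sqrt(A_k) grow by
   at least 1 / (2 sqrt(L_u)); for mu > 0 it gives a >= sqrt(q_u) A_(k+1),
   that is, A_k <= (1 - sqrt(q_u)) A_(k+1). *)

Require Import Defs.
From HB Require Import structures.
From mathcomp Require Import all_boot all_order all_algebra.
From mathcomp Require Import all_classical all_reals all_analysis.
From mathcomp Require Import ring lra.

Set Implicit Arguments.
Unset Strict Implicit.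
Unset Printing Implicit Defensive.

Import Order.TTheory GRing.Theory Num.Theory.
Import numFieldNormedType.Exports.
Local Open Scope classical_set_scope.
Local Open Scope ring_scope.

Section Euclidean.
Context {R : realType} {n : nat}.
Implicit Types (u v x y d : 'rV[R]_n) (f : 'rV[R]_n -> R).

Lemma enorm_sqr u : enorm u ^+ 2 = dotv u u.
Proof.
by rewrite sqr_sqrtr// sumr_ge0// => i _; rewrite -expr2 sqr_ge0.
Qed.

Lemma enormZ (a : R) u : enorm (a *: u) = `|a| * enorm u.
Proof.
rewrite /enorm -sqrtr_sqr -sqrtrM ?sqr_ge0//; congr Num.sqrt.
by rewrite /dotv mulr_sumr; apply: eq_bigr => i _; rewrite !mxE; ring.
Qed.

Lemma dotvBl u v d : dotv (u - v) d = dotv u d - dotv v d.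
Proof. by rewrite -sumrB; apply: eq_bigr => i _; rewrite !mxE mulrBl. Qed.

(* Expand 0 <= enorm (u - c *: v) ^+ 2. *)
Lemma dotv_le_of_enorm_le (c : R) u v :
  0 < c -> enorm u <= c * enorm v -> dotv u v <= c * enorm v ^+ 2.
Proof.
move=> c0 uv.
have u2 : enorm u ^+ 2 <= c ^+ 2 * enorm v ^+ 2.
  by rewrite -exprMn lerXn2r ?nnegrE ?sqrtr_ge0// mulr_ge0 ?sqrtr_ge0 ?ltW.
have uv2 : enorm (u - c *: v) ^+ 2
    = enorm u ^+ 2 - 2 * c * dotv u v + c ^+ 2 * enorm v ^+ 2.
  rewrite !enorm_sqr /dotv !mulr_sumr -sumrB -big_split/=.
  by apply: eq_bigr => i _; rewrite !mxE; ring.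
have uv0 := sqr_ge0 (enorm (u - c *: v)).
rewrite -(ler_pM2l c0).
nra.
Qed.

Lemma derive_gradient f x d :
  differentiable (f : 'rV[R]_n -> R^o) x ->
  'D_d (f : 'rV[R]_n -> R^o) x = dotv (gradient f x) d.
Proof.
move=> df; rewrite deriveE// {1}[d]row_sum_delta linear_sum.
by apply: eq_bigr => i _; rewrite linearZ mxE deriveE//= mulrC.
Qed.

Lemma is_derive_line f x d (t : R) :
  differentiable (f : 'rV[R]_n -> R^o) (x + t *: d) ->
  is_derive t 1 (fun r : R => f (x + r *: d) : R^o)
    (dotv (gradient f (x + t *: d)) d).
Proof.
move=> df; rewrite -derive_gradient//.
(* Both derivatives are limits of the same difference quotient, so derivability and value transfer
   together. *)
have eq_quot : (fun h : R => h^-1 *: (f (x + (h *: (1 : R) + t) *: d) -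
                                 f (x + t *: d) : R^o)) =
   (fun h : R => h^-1 *: (f (h *: d + (x + t *: d)) - f (x + t *: d) : R^o)).
  by apply/funext => h; rewrite scalerDl addrCA [h *: 1]mulr1.
have := @diff_derivable _ _ _ f _ d df.
split.
- by rewrite /derivable/= eq_quot.
- by rewrite /derive/= eq_quot.
Qed.

(** Along the segment from [y] to [x], subtract from [f] the nonconstant part of the model. The
    result [h] satisfies [h 1 - h 0 = dh c] by the mean value theorem, and the Lipschitz bound makes
    [dh c] nonpositive. *)
Lemma descent_lemma f (L : R) x y :
  (forall z, differentiable (f : 'rV[R]_n -> R^o) z) ->
  0 < L -> lipschitz_gradient L f -> f x <= quad_model f L y x.
Proof.
move=> df L0 Lf; pose d := x - y.
pose h (t : R) : R^o :=
  f (y + t *: d) - (t * dotv (gradient f y) d + t ^+ 2 * (L / 2 * enorm d ^+ 2)).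
pose dh (t : R) : R := dotv (gradient f (y + t *: d)) d
  - (dotv (gradient f y) d + 2 * t * (L / 2 * enorm d ^+ 2)).
have hD (t : R) : is_derive t 1 h (dh t).
  have fD := @is_derive_line f y d t (df _).
  apply: is_derive_eq.
  rewrite /dh /GRing.scale/=; ring.
have [|c] := @MVT R h dh 0 1 ltr01 (fun t _ => hD t).
  by apply: derivable_within_continuous => t _; apply: ex_derive.
rewrite in_itv/= => /andP[c0 _].
(* The gradients at [y + c *: d] and [y] differ by at most [L * c * enorm d]. The constant [L * c]
   is positive because [c] lies in the open interval. *)
have : dh c <= 0.
  have := @dotv_le_of_enorm_le (L * c) (gradient f (y + c *: d) - gradient f y) d.
  rewrite mulr_gt0// dotvBl => /(_ isT); move: (Lf (y + c *: d) y).
  rewrite addrAC subrr add0r enormZ gtr0_norm// mulrA => le1 /(_ le1).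
  by rewrite /dh; lra.
rewrite /h /quad_model -/d scale1r scale0r addr0 [y + d]addrC subrK; lra.
Qed.

End Euclidean.

Section WeightUpdate.
Context {R : realType} {n : nat}.
Variables (mu_f mu_Psi Lhat : R) (s : acgm_state R n).
Hypotheses (mu_f_lt : mu_f < Lhat) (mu_ge0 : 0 <= mu_f + mu_Psi).
Hypotheses (A_ge0 : 0 <= st_A s) (gamma_gt0 : 0 < st_gamma s).

Lemma a_hat_gt0 : 0 < a_hat mu_f mu_Psi s Lhat.
Proof.
rewrite /a_hat divr_gt0 ?mulr_gt0 ?subr_gt0// -addrA ltr_wpDr//.
by rewrite addr_ge0 ?sqrtr_ge0// mulr_ge0.
Qed.

(** [a_hat] is the larger root of [(Lhat - mu_f) a^2 = (gamma + A mu) a + A gamma]; adding [mu a^2]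
    to both sides makes the right side factor. *)
Lemma a_hat_root :
  (Lhat + mu_Psi) * a_hat mu_f mu_Psi s Lhat ^+ 2
  = A_hat mu_f mu_Psi s Lhat * gamma_hat mu_f mu_Psi s Lhat.
Proof.
rewrite /A_hat /gamma_hat /a_hat.
set A := st_A s; set g := st_gamma s; set D := _ + 4 * _ * _ * _.
have D0 : 0 <= D.
  by rewrite addr_ge0 ?sqr_ge0// !mulr_ge0 ?subr_ge0// ltW.
have : Num.sqrt D ^+ 2 = D by rewrite sqr_sqrtr.
set S := Num.sqrt D; rewrite /D => S2.
have L0 : Lhat - mu_f != 0 by rewrite gt_eqF ?subr_gt0.
move: S2 => /eqP; rewrite -subr_eq0 => /eqP S2.
apply/eqP; rewrite -subr_eq0; apply/eqP.
(* The difference of the two sides is a multiple of [S ^+ 2 - D], which vanishes. *)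
transitivity ((4 * (Lhat - mu_f))^-1 *
  (S ^+ 2 - ((g + A * (mu_f + mu_Psi)) ^+ 2 + 4 * (Lhat - mu_f) * A * g))).
  by field.
by rewrite S2 mulr0.
Qed.

End WeightUpdate.

(** Every estimate but the first is [r_u] times a rejected one, so a case analysis suffices. A
    rejected estimate is at most [L_f]: a larger one is also a Lipschitz constant of the gradient,
    and the descent lemma would accept it. *)
Lemma tried_le {R : realType} {n : nat} (f : 'rV[R]_n -> R) Psi
    (mu_f mu_Psi r_u r_d L_f L_u : R) (s : acgm_state R n) (Lhat : R) :
  (forall x, differentiable (f : 'rV[R]_n -> R^o) x) ->
  lipschitz_gradient L_f f -> 0 < L_f -> 0 <= r_u ->
  r_u * L_f <= L_u -> r_d * st_L s <= L_u ->
  tried f Psi mu_f mu_Psi r_u r_d s Lhat -> Lhat <= L_u.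
Proof.
move=> df Lf Lf0 ru0 ruL rdL; case=> // {}Lhat x _ _ nsd.
apply: le_trans ruL; apply: ler_wpM2l => //; rewrite leNgt; apply/negP => ltL.
move/negP: nsd; apply; apply: descent_lemma => //; first exact: lt_trans ltL.
move=> u v; apply: le_trans (Lf u v) _.
by apply: ler_wpM2r; rewrite ?sqrtr_ge0 ?ltW.
Qed.

Section WeightGrowth.
Context {R : realType}.
Implicit Types (A a L mu : R).

Lemma sqr_growth A a L (m : nat) : 0 < L -> 0 <= a ->
  A + a <= L * a ^+ 2 -> m.+1%:R ^+ 2 / (4 * L) <= A ->
  m.+2%:R ^+ 2 / (4 * L) <= A + a.
Proof.
rewrite -[m.+2%:R]natr1; set k : R := m.+1%:R => L0 a0 aL.
have k1 : 1 <= k by rewrite ler1n.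
rewrite !ler_pdivrMr ?mulr_gt0// => kA.
(* This scaling avoids square roots: the hypothesis becomes [4 L A + 2 b <= b^2], and the goal
   follows from [4 L A + 2 b >= k^2 + 2 (k + 1)]. *)
pose b := 2 * L * a.
have hb : 0 <= b by rewrite /b !mulr_ge0// ltW.
have : A * (4 * L) + 2 * b <= b ^+ 2.
  by rewrite /b; have := ler_wpM2l (ltW (mulr_gt0 (ltr0n _ 4) L0)) aL; lra.
have -> : (A + a) * (4 * L) = A * (4 * L) + 2 * b by rewrite /b; ring.
(* Here [(b - 1)^2 >= k^2 + 1]; the branch [b - 1 <= - k] is excluded by [0 <= b] and [1 <= k],
   except for [b = 0], where [ineq] fails. *)
move=> ineq; have : k + 1 <= b by nra.
nra.
Qed.

Lemma geometric_growth A a L mu : 0 < mu -> 0 < L -> 0 <= A -> 0 <= a ->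
  (A + a) * (1 + (A + a) * mu) <= L * a ^+ 2 ->
  A <= (1 - Num.sqrt (mu / L)) * (A + a).
Proof.
move=> mu0 L0 A0 a0 H.
(* Squared, this reads [mu (A + a)^2 <= L a^2], which is the hypothesis without its nonnegative term
   [A + a]. *)
suff : Num.sqrt (mu / L) * (A + a) <= a by lra.
have Aa0 : 0 <= A + a by rewrite addr_ge0.
rewrite -(@ler_pXn2r _ 2)// ?nnegrE ?mulr_ge0 ?sqrtr_ge0//.
rewrite exprMn sqr_sqrtr; last by rewrite divr_ge0 ?ltW.
rewrite mulrAC ler_pdivrMr//.
nra.
Qed.

End WeightGrowth.

Theorem theorem4 (R : realType) (n : nat)
    (f : 'rV[R]_n -> R) (Psi : 'rV[R]_n -> \bar R) (X : set 'rV[R]_n)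
    (L_f mu_f mu_Psi L0 r_u r_d : R) (x0 : 'rV[R]_n)
    (s : nat -> acgm_state R n)
    (f_convex : convex_function setT f)
    (f_diff : forall x, differentiable (f : 'rV[R]_n -> R^o) x)
    (L_f_gt0 : 0 < L_f)
    (f_lip : lipschitz_gradient L_f f)
    (mu_f_ge0 : 0 <= mu_f)
    (f_sconvex : strongly_convex_parameter mu_f f)
    (Psi_proper : eproper Psi)
    (Psi_lsc : lower_semicontinuous Psi)
    (Psi_convex : econvex_function Psi)
    (mu_Psi_ge0 : 0 <= mu_Psi)
    (Psi_sconvex : estrongly_convex_parameter mu_Psi Psi)
    (X_closed : closed X)
    (X_convex : convex_set X)
    (Psi_infinite : forall x, ~ X x -> Psi x = +oo%E)
    (minimizers_nonempty : argmin (fun x => (f x)%:E + Psi x)%E !=set0)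
    (L0_gt0 : 0 < L0)
    (r_u_gt1 : 1 < r_u)
    (r_d_gt0 : 0 < r_d)
    (r_d_lt1 : r_d < 1)
    (s_run : acgm_run f Psi mu_f mu_Psi r_u r_d x0 L0 s)
    (tried_gt : forall k Lhat,
       tried f Psi mu_f mu_Psi r_u r_d (s k) Lhat -> mu_f < Lhat) :
  let mu := mu_f + mu_Psi in
  let L_u := Num.max (r_u * L_f) (r_d * L0) in
  let q_u := mu / (L_u + mu_Psi) in
  (mu = 0 -> forall k, (1 <= k)%N ->
     k.+1%:R ^+ 2 / (4 * L_u) <= st_A (s k)) /\
  (0 < mu -> forall k, (1 <= k)%N ->
     (L_u - mu_f)^-1 * (1 - Num.sqrt q_u) ^- (k - 1) <= st_A (s k)).
Proof.
move=> mu L_u q_u.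
have mu_ge0 : 0 <= mu by rewrite addr_ge0.
have [s0 step] := s_run.
have ru0 : 0 <= r_u by rewrite ltW// (lt_trans ltr01).
(* The invariant bounds [r_d * L_k] and not [L_k], since [L0] itself may exceed [L_u]. *)
have state_inv k : r_d * st_L (s k) <= L_u /\ st_gamma (s k) = 1 + st_A (s k) * mu
    /\ 0 <= st_A (s k).
  elim: k => [|k [IHL [IHg IHA]]].
    by rewrite s0/= mul0r addr0 le_max lexx orbT.
  have [L [x [Lt _ _ ->]]] /= := step k.
  have g0 : 0 < st_gamma (s k) by rewrite IHg ltr_pwDl// mulr_ge0.
  have muL := tried_gt _ _ Lt.
  have LLu : L <= L_u.
    apply: tried_le f_diff f_lip L_f_gt0 ru0 _ IHL Lt.
    by rewrite le_max lexx.
  have L_ge0 : 0 <= L by rewrite (le_trans mu_f_ge0)// ltW.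
  split; [by nra|split].
    by rewrite /gamma_hat /A_hat IHg /mu; ring.
  by rewrite addr_ge0// ltW// a_hat_gt0.
(* From here on the run enters only through these scalar relations, [A_k >= 0] and [A_0 = 0]. *)
have main k : exists L a, [/\ mu_f < L, L <= L_u, 0 < a,
    st_A (s k.+1) = st_A (s k) + a
    & (L + mu_Psi) * a ^+ 2 = st_A (s k.+1) * (1 + st_A (s k.+1) * mu)].
  have [rdL [Eg A0]] := state_inv k; have [_ [Eg1 _]] := state_inv k.+1.
  have g0 : 0 < st_gamma (s k) by rewrite Eg ltr_pwDl// mulr_ge0.
  have [L [x [Lt _ _ E]]] := step k; have muL := tried_gt _ _ Lt.
  exists L, (a_hat mu_f mu_Psi (s k) L); split => //.
  - by apply: tried_le f_diff f_lip L_f_gt0 ru0 _ rdL Lt; rewrite le_max lexx.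
  - exact: a_hat_gt0.
  - by rewrite E.
  - by rewrite -Eg1 E/= a_hat_root.
have A_ge0 k : 0 <= st_A (s k) by have [_ []] := state_inv k.
have A0E : st_A (s 0%N) = 0 by rewrite s0.
have [L1 [a1 [muL1 L1u a1_gt0 ]]] := main 0%N.
rewrite A0E add0r => A1E; rewrite A1E => a1E.
have L_u_gt : mu_f < L_u by apply: lt_le_trans L1u.
(* As [A_0 = 0], one factor [a1] cancels from the weight equation. The resulting bound on [A_1]
   starts both inductions; for [mu = 0] it is exactly [2^2 / (4 L_u)]. *)
have {}a1E : (L1 - mu_f) * a1 = 1.
  by apply: (mulIf (lt0r_neq0 a1_gt0)); move: a1E; rewrite /mu; lra.
have A1 : (L_u - mu_f)^-1 <= st_A (s 1%N).
  rewrite A1E -div1r ler_pdivrMr ?subr_gt0// -a1E mulrC.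
  by rewrite ler_pM2l// lerD2r.
have L_u_gt0 : 0 < L_u by apply: le_lt_trans L_u_gt.
split=> [mu0 [//|k] _|mu_gt0 [//|k] _].
- have mu_f0 : mu_f = 0 by move: mu0; rewrite /mu; lra.
  have mu_Psi0 : mu_Psi = 0 by move: mu0; rewrite /mu; lra.
  elim: k => [|k IHk].
    apply: le_trans A1; rewrite mu_f0 subr0 invfM mulrA -natrX mulfV ?mul1r//.
  have [L [a [muL LLu a_gt0 AE root]]] := main k.+1.
  rewrite AE; apply: sqr_growth IHk => //; first exact: ltW.
  move: root; rewrite mu_Psi0 mu0 mulr0 !addr0 mulr1 AE => <-.
  by rewrite ler_wpM2r ?sqr_ge0.
- have Lmu_gt0 : 0 < L_u + mu_Psi by rewrite ltr_wpDr.
  (* [q_u < 1] because [mu_f < L_u]; positivity allows a factor to be moved across the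
     inequality. *)
  have r_gt0 : 0 < 1 - Num.sqrt q_u.
    rewrite subr_gt0 -[ltRHS]sqrtr1 ltr_sqrt// /q_u ltr_pdivrMr// mul1r.
    by rewrite /mu ltrD2r.
  rewrite subn1/=; elim: k => [|k IHk]; first by rewrite expr0 invr1 mulr1.
  have [L [a [muL LLu a_gt0 AE root]]] := main k.+1.
  rewrite exprSr invfM mulrA ler_pdivrMr// [leRHS]mulrC.
  apply: le_trans IHk _; rewrite AE.
  (* Used with [L_u + mu_Psi] as its [L]: replacing [L] by [L_u] turns the weight equation into the
     required inequality. *)
  apply: geometric_growth => //; first exact: ltW.
  by rewrite -AE -root ler_wpM2r ?sqr_ge0// lerD2r.
Qed.
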